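(* If $\mathbf{C}$ is a category with finite colimits, then $\mathrm{2Cosp}(\mathbf{C})_0$ is a Verity double bicategory.
   Context: \textbf{The structure $\mathrm{2Cosp}(\mathbf{C})_0$.} A cospan from $X$ to $Y$ in $\mathbf{C}$ is a diagram $X\to S\leftarrow Y$; a map of cospans $(S)\to(S')$ with the same $X,Y$ is a morphism $S\to S'$ commuting with the maps from $X$ and $Y$. $\mathrm{Cosp}(\mathbf{C})$ is the bicategory with objects those of $\mathbf{C}$, morphisms cospans composed by pushout, and 2-morphisms the maps of cospans. $\mathrm{2Cosp}(\mathbf{C})_0$ has: \begin{itemize} \item objects: the objects of $\mathbf{C}$; \item horizontal and vertical bicategories $\mathbf{Hor}=\mathbf{Ver}$, both equal to the sub-bicategory of $\mathrm{Cosp}(\mathbf{C})$ containing all objects and morphisms but only the invertible cospan maps as 2-morphisms; \item squares: isomorphism classes of commuting diagrams $$\begin{array}{ccccc} X&\to&S&\leftarrow&Y\\ \downarrow&&\downarrow&&\downarrow\\ T_X&\to&M&\leftarrow&T_Y\\ \uparrow&&\uparrow&&\uparrow\\ X'&\to&S'&\leftarrow&Y'\end{array}$$ in $\mathbf{C}$ (top and bottom sides the horizontal cospans $S,S'$; left and right sides the vertical cospans $T_X,T_Y$), where two diagrams are isomorphic if they differ only in the middle objects $M,M'$ and the maps into them, and there is an isomorphism $M\to M'$ making the combined diagram commute. \end{itemize} Horizontal (vertical) composition of squares is given by composing, by pushout, the three horizontal (vertical) cospans of which each square consists. The action of a 2-morphism (an invertible cospan map $\alpha:S\to S_2$ on a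 side of the square) on a square replaces that side $S$ by $S_2$, with the map into $M$ obtained by composing with the isomorphism $\alpha$ (or its inverse, as needed). \textbf{Verity double bicategory.} A \emph{Verity double bicategory} consists of: a class $\mathrm{Obj}$ of objects; horizontal and vertical bicategories $\mathbf{Hor}$, $\mathbf{Ver}$, each having $\mathrm{Obj}$ as objects; and for every quadruple of a horizontal morphism $h:a\to b$ (top), vertical morphism $v:a\to c$ (left), vertical morphism $v':b\to d$ (right), horizontal morphism $h':c\to d$ (bottom), a class of squares with that boundary. The class of all squares is $\mathbf{Squ}$, with maps $s_h,t_h$ (top, bottom) to morphisms of $\mathbf{Hor}$ and $s_v,t_v$ (left, right) to morphisms of $\mathbf{Ver}$ satisfying $s(s_h)=s(s_v)$, $t(s_h)=s(t_v)$, $s(t_h)=t(s_v)$, $t(t_h)=t(t_v)$. In addition: \begin{itemize} \item There are a vertical composition $F\otimes_V G$ ($F$ above $G$, when the bottom of $F$ is the top of $G$) and a horizontal composition $F\otimes_H G$ ($F$ left of $G$, when the right side of $F$ is the left side of $G$); the sides of the composite are the evident sides and composites of sides. They satisfy the interchange law $(F\otimes_VF')\otimes_H(G\otimes_VG')=(F\otimes_HG)\otimes_V(F'\otimes_HG')$. \item There are unit squares: for each vertical $f:x\to y$ a square $1_f$ with left and right sides $f$, top $1_x$, bottom $1_y$; similarly for each horizontal morphism, for vertical composition. \item There are left and right actions $\star_V$, $\star_H$ of vertical and horizontal 2-morphisms on squares: a 2-morphism $\alpha:v'\Rightarrow w$ (resp. $\alpha:w\Rightarrow v$) acts on a square with right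 side $v'$ (resp. left side $v$) giving a square with that side replaced by $w$; a 2-morphism $\alpha:k\Rightarrow h$ (resp. $\alpha:h'\Rightarrow k$) acts on a square with top $h$ (resp. bottom $h'$) giving a square with that side replaced by $k$. The actions satisfy interchange with composition: $(F\otimes_HF')\star_H(\alpha*\alpha')=(F\star_H\alpha)\otimes_H(F'\star_H\alpha')$, where $\alpha*\alpha'$ is the horizontal composite of 2-morphisms (similarly vertically); $(F\otimes_HG)\star_V\alpha=F\otimes_H(G\star_V\alpha)$ (similarly vertically); $\alpha\star(S\star\beta)=(\alpha\star S)\star\beta$ for both $\star_H$ and $\star_V$; and horizontal and vertical actions are independent: $\alpha\star_H(\beta\star_VS)=\beta\star_V(\alpha\star_HS)$, and similarly for right actions. \item Compatibility with associators: for three horizontally composable squares $F,G,H$ with tops $f,g,h$ and bottoms $f',g',h'$, the square obtained from $(F\otimes_HG)\otimes_HH$ by acting on its top with the associator between $h\circ(g\circ f)$ and $(h\circ g)\circ f$ equals the square obtained from $F\otimes_H(G\otimes_HH)$ by acting on its bottom with the associator between $(h'\circ g')\circ f'$ and $h'\circ(g'\circ f')$; similarly vertically. \item Compatibility with unitors: for a square $F$ with left side $g$ and right side $g'$, acting on the top and bottom of $F\otimes_H1_{g'}$, respectively of $1_g\otimes_HF$, by the unitors yields $F$; similarly vertically. \end{itemize} *)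

(* Defs.v *)
From Stdlib Require Import List FinFun RelationClasses.
From Stdlib Require Import ProofIrrelevance FunctionalExtensionality PropExtensionality.

Set Implicit Arguments.
Unset Strict Implicit.
Unset Printing Implicit Defensive.

Declare Scope cat_scope.
Delimit Scope cat_scope with cat.
Local Open Scope cat_scope.

Record category := Category {
  ob :> Type;
  hom : ob -> ob -> Type;
  idm : forall x, hom x x;
  comp : forall x y z, hom y z -> hom x y -> hom x z;
  comp_idl : forall x y (f : hom x y), comp (idm y) f = f;
  comp_idr : forall x y (f : hom x y), comp f (idm x) = f;
  comp_assoc : forall w x y z (h : hom y z) (g : hom x y) (f : hom w x),
    comp h (comp g f) = comp (comp h g) f
}.
Arguments idm {_} _.
Notation "g ∘ f" := (comp g f) (at level 40, left associativity) : cat_scope.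

Record functor (J C : category) := Functor {
  fob :> J -> C;
  fmap : forall i j, hom i j -> hom (fob i) (fob j);
  fmap_id : forall i, fmap (idm i) = idm (fob i);
  fmap_comp : forall i j k (g : hom j k) (f : hom i j),
    fmap (g ∘ f) = fmap g ∘ fmap f
}.

Definition finite_category (J : category) : Prop :=
  Finite J /\ forall i j : J, Finite (hom i j).

Record cocone {J C : category} (D : functor J C) := Cocone {
  cc_ob : C;
  cc_leg : forall j, hom (D j) cc_ob;
  cc_nat : forall i j (f : hom i j), cc_leg j ∘ fmap D f = cc_leg i
}.

Record colimit {J C : category} (D : functor J C) := Colimit {
  colim_cocone : cocone D;
  colim_desc : forall K : cocone D, hom (cc_ob colim_cocone) (cc_ob K);
  colim_desc_leg : forall (K : cocone D) j,
    colim_desc K ∘ cc_leg colim_cocone j = cc_leg K j;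
  colim_desc_unique : forall (K : cocone D) (u : hom (cc_ob colim_cocone) (cc_ob K)),
    (forall j, u ∘ cc_leg colim_cocone j = cc_leg K j) -> u = colim_desc K
}.

(** Finite colimits are given as data: a chosen colimit of each finite diagram. *)
Definition finite_colimits (C : category) : Type :=
  forall J : category, finite_category J -> forall D : functor J C, colimit D.

Record pushout {C : category} {A B D : C} (f : hom A B) (g : hom A D) := Pushout {
  po_ob : C;
  po_inl : hom B po_ob;
  po_inr : hom D po_ob;
  po_comm : po_inl ∘ f = po_inr ∘ g;
  po_desc : forall (Z : C) (u : hom B Z) (v : hom D Z), u ∘ f = v ∘ g -> hom po_ob Z;
  po_desc_inl : forall Z u v (e : u ∘ f = v ∘ g), @po_desc Z u v e ∘ po_inl = u;
  po_desc_inr : forall Z u v (e : u ∘ f = v ∘ g), @po_desc Z u v e ∘ po_inr = v;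
  po_ext : forall Z (s t : hom po_ob Z),
    s ∘ po_inl = t ∘ po_inl -> s ∘ po_inr = t ∘ po_inr -> s = t
}.

Arguments po_desc {_ _ _ _ _ _} _ {_} _ _ _.

Definition chosen_pushouts (C : category) : Type :=
  forall (A B D : C) (f : hom A B) (g : hom A D), pushout f g.

Inductive span_ob := span_0 | span_l | span_r.

Definition span_hom (x y : span_ob) : Type :=
  match x, y with
  | span_0, _ | span_l, span_l | span_r, span_r => unit
  | _, _ => Empty_set
  end.

Definition span_id (x : span_ob) : span_hom x x :=
  match x with span_0 => tt | span_l => tt | span_r => tt end.

Definition span_comp (x y z : span_ob) : span_hom y z -> span_hom x y -> span_hom x z.
Proof.
  destruct x, y, z; simpl; intros g f; first [exact tt | now destruct g | now destruct f].
Defined.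

Program Definition walking_span : category :=
  {| ob := span_ob; hom := span_hom; idm := span_id; comp := span_comp |}.
Next Obligation. destruct x, y; destruct f; reflexivity. Qed.
Next Obligation. destruct x, y; destruct f; reflexivity. Qed.
Next Obligation.
  destruct w, x; try destruct f; destruct y; try destruct g; destruct z; try destruct h;
    reflexivity.
Qed.

Lemma walking_span_finite : finite_category walking_span.
Proof.
  split.
  - exists (span_0 :: span_l :: span_r :: nil); intros []; simpl; tauto.
  - intros [] []; first [exists (tt :: nil); intros []; simpl; tauto
                        | exists nil; intros []].
Qed.

Section SpanDiagram.
Context {C : category} {A B D : C} (f : hom A B) (g : hom A D).

Definition span_fob (x : span_ob) : C :=
  match x with span_0 => A | span_l => B | span_r => D end.

Definition span_fmap (x y : span_ob) : span_hom x y -> hom (span_fob x) (span_fob y) :=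
  match x, y return span_hom x y -> hom (span_fob x) (span_fob y) with
  | span_0, span_0 => fun _ => idm A
  | span_0, span_l => fun _ => f
  | span_0, span_r => fun _ => g
  | span_l, span_l => fun _ => idm B
  | span_r, span_r => fun _ => idm D
  | span_l, _ => fun e => match e with end
  | span_r, _ => fun e => match e with end
  end.

Program Definition span_functor : functor walking_span C :=
  {| fob := (span_fob : walking_span -> C); fmap := span_fmap |}.
Next Obligation. destruct i; reflexivity. Qed.
Next Obligation.
  destruct i, j; try destruct f0; destruct k; try destruct g0; simpl;
    rewrite ?comp_idl, ?comp_idr; reflexivity.
Qed.

Program Definition span_cocone (Z : C) (u : hom B Z) (v : hom D Z) (e : u ∘ f = v ∘ g) :
  cocone span_functor :=
  {| cc_ob := Z;
     cc_leg := fun x : walking_span =>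
       match x return hom (span_fob x) Z with
       | span_0 => u ∘ f | span_l => u | span_r => v end |}.
Next Obligation.
  destruct i, j; try destruct f0; simpl; rewrite ?comp_idr; auto.
Qed.

Program Definition pushout_of_colimit (L : colimit span_functor) : pushout f g :=
  {| po_ob := cc_ob (colim_cocone L);
     po_inl := cc_leg (colim_cocone L) (span_l : walking_span);
     po_inr := cc_leg (colim_cocone L) (span_r : walking_span);
     po_desc := fun Z u v e => colim_desc L (span_cocone e) |}.
Next Obligation.
  transitivity (cc_leg (colim_cocone L) (span_0 : walking_span)); [|symmetry].
  - exact (@cc_nat _ _ _ (colim_cocone L) span_0 span_l tt).
  - exact (@cc_nat _ _ _ (colim_cocone L) span_0 span_r tt).
Qed.
Next Obligation. exact (colim_desc_leg L (span_cocone e) (span_l : walking_span)). Qed.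
Next Obligation. exact (colim_desc_leg L (span_cocone e) (span_r : walking_span)). Qed.
Next Obligation.
  assert (nat_l : cc_leg (colim_cocone L) (span_l : walking_span) ∘ f
                  = cc_leg (colim_cocone L) (span_0 : walking_span))
    by exact (@cc_nat _ _ _ (colim_cocone L) span_0 span_l tt).
  assert (nat_r : cc_leg (colim_cocone L) (span_r : walking_span) ∘ g
                  = cc_leg (colim_cocone L) (span_0 : walking_span))
    by exact (@cc_nat _ _ _ (colim_cocone L) span_0 span_r tt).
  assert (e : (t ∘ cc_leg (colim_cocone L) (span_l : walking_span)) ∘ f
              = (t ∘ cc_leg (colim_cocone L) (span_r : walking_span)) ∘ g).
  { etransitivity; [symmetry; apply comp_assoc|].
    etransitivity; [|apply comp_assoc].
    exact (f_equal (comp t) (eq_trans nat_l (eq_sym nat_r))). }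
  assert (e0 : t ∘ cc_leg (colim_cocone L) (span_0 : walking_span)
               = (t ∘ cc_leg (colim_cocone L) (span_l : walking_span)) ∘ f).
  { etransitivity; [|apply comp_assoc]. exact (f_equal (comp t) (eq_sym nat_l)). }
  assert (e0' : s ∘ cc_leg (colim_cocone L) (span_0 : walking_span)
               = (s ∘ cc_leg (colim_cocone L) (span_l : walking_span)) ∘ f).
  { etransitivity; [|apply comp_assoc]. exact (f_equal (comp s) (eq_sym nat_l)). }
  transitivity (colim_desc L (span_cocone e)); [|symmetry];
    apply (@colim_desc_unique _ _ _ L (span_cocone e)); intros []; simpl; auto.
  exact (eq_trans e0' (f_equal (fun x => comp x f) H)).
Qed.

End SpanDiagram.

Definition pushouts_of {C : category} (K : finite_colimits C) : chosen_pushouts C :=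
  fun A B D f g => pushout_of_colimit (K walking_span walking_span_finite (span_functor f g)).

Declare Scope bicat_scope.
Delimit Scope bicat_scope with bicat.

Record bicat_data (Obj : Type) := BicatData {
  cell1 :> Obj -> Obj -> Type;
  cell2 : forall a b, cell1 a b -> cell1 a b -> Type;
  id1 : forall a, cell1 a a;
  comp1 : forall a b c, cell1 b c -> cell1 a b -> cell1 a c;
  id2 : forall a b (f : cell1 a b), cell2 f f;
  vcomp2 : forall a b (f g h : cell1 a b), cell2 g h -> cell2 f g -> cell2 f h;
  hcomp2 : forall a b c (f f' : cell1 a b) (g g' : cell1 b c),
    cell2 g g' -> cell2 f f' -> cell2 (comp1 g f) (comp1 g' f');
  lunit : forall a b (f : cell1 a b), cell2 (comp1 (id1 b) f) f;
  lunit_inv : forall a b (f : cell1 a b), cell2 f (comp1 (id1 b) f);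
  runit : forall a b (f : cell1 a b), cell2 (comp1 f (id1 a)) f;
  runit_inv : forall a b (f : cell1 a b), cell2 f (comp1 f (id1 a));
  associ : forall a b c d (h : cell1 c d) (g : cell1 b c) (f : cell1 a b),
    cell2 (comp1 (comp1 h g) f) (comp1 h (comp1 g f));
  associ_inv : forall a b c d (h : cell1 c d) (g : cell1 b c) (f : cell1 a b),
    cell2 (comp1 h (comp1 g f)) (comp1 (comp1 h g) f)
}.
Arguments id1 {_} _ _.
Arguments id2 {_} _ {_ _} _.
Arguments lunit {_} _ {_ _} _.
Arguments lunit_inv {_} _ {_ _} _.
Arguments runit {_} _ {_ _} _.
Arguments runit_inv {_} _ {_ _} _.
Arguments associ {_} _ {_ _ _ _} _ _ _.
Arguments associ_inv {_} _ {_ _ _ _} _ _ _.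

Notation "f ⇒ g" := (cell2 f g) (at level 70, no associativity) : bicat_scope.
Notation "g ⊙ f" := (comp1 g f) (at level 40, left associativity) : bicat_scope.
Notation "β • α" := (vcomp2 β α) (at level 45, left associativity) : bicat_scope.
Notation "β ⊛ α" := (hcomp2 β α) (at level 42, left associativity) : bicat_scope.

Local Open Scope bicat_scope.

Record is_bicategory (Obj : Type) (B : bicat_data Obj) : Prop := {
  bc_idl : forall a b (f g : B a b) (α : f ⇒ g), id2 B g • α = α;
  bc_idr : forall a b (f g : B a b) (α : f ⇒ g), α • id2 B f = α;
  bc_assoc : forall a b (f g h k : B a b) (γ : h ⇒ k) (β : g ⇒ h) (α : f ⇒ g),
    γ • (β • α) = (γ • β) • α;
  bc_hcomp_id : forall a b c (g : B b c) (f : B a b),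
    id2 B g ⊛ id2 B f = id2 B (g ⊙ f);
  bc_interchange : forall a b c (f f' f'' : B a b) (g g' g'' : B b c)
      (β' : g' ⇒ g'') (β : g ⇒ g') (α' : f' ⇒ f'') (α : f ⇒ f'),
    (β' • β) ⊛ (α' • α) = (β' ⊛ α') • (β ⊛ α);
  bc_lunit_nat : forall a b (f f' : B a b) (α : f ⇒ f'),
    lunit B f' • (id2 B (id1 B b) ⊛ α) = α • lunit B f;
  bc_runit_nat : forall a b (f f' : B a b) (α : f ⇒ f'),
    runit B f' • (α ⊛ id2 B (id1 B a)) = α • runit B f;
  bc_associ_nat : forall a b c d (h h' : B c d) (g g' : B b c) (f f' : B a b)
      (γ : h ⇒ h') (β : g ⇒ g') (α : f ⇒ f'),
    associ B h' g' f' • ((γ ⊛ β) ⊛ α) = (γ ⊛ (β ⊛ α)) • associ B h g f;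
  bc_lunitK : forall a b (f : B a b), lunit_inv B f • lunit B f = id2 B (id1 B b ⊙ f);
  bc_lunitVK : forall a b (f : B a b), lunit B f • lunit_inv B f = id2 B f;
  bc_runitK : forall a b (f : B a b), runit_inv B f • runit B f = id2 B (f ⊙ id1 B a);
  bc_runitVK : forall a b (f : B a b), runit B f • runit_inv B f = id2 B f;
  bc_associK : forall a b c d (h : B c d) (g : B b c) (f : B a b),
    associ_inv B h g f • associ B h g f = id2 B ((h ⊙ g) ⊙ f);
  bc_associVK : forall a b c d (h : B c d) (g : B b c) (f : B a b),
    associ B h g f • associ_inv B h g f = id2 B (h ⊙ (g ⊙ f));
  bc_triangle : forall a b c (g : B b c) (f : B a b),
    (id2 B g ⊛ lunit B f) • associ B g (id1 B b) f = runit B g ⊛ id2 B f;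
  bc_pentagon : forall a b c d e (k : B d e) (h : B c d) (g : B b c) (f : B a b),
    (id2 B k ⊛ associ B h g f) • (associ B k (h ⊙ g) f • (associ B k h g ⊛ id2 B f))
    = associ B k h (g ⊙ f) • associ B (k ⊙ h) g f
}.

(** The sub-bicategory of all objects, all 1-cells and the invertible 2-cells *)

Section Core.
Context {Obj : Type} (B : bicat_data Obj) (HB : is_bicategory B).

Record inv2 {a b : Obj} (f g : B a b) := Inv2 {
  fwd : f ⇒ g;
  bwd : g ⇒ f;
  bwd_fwd : bwd • fwd = id2 B f;
  fwd_bwd : fwd • bwd = id2 B g
}.

Definition inv2_id {a b} (f : B a b) : inv2 f f :=
  {| fwd := id2 B f; bwd := id2 B f;
     bwd_fwd := bc_idl HB _; fwd_bwd := bc_idl HB _ |}.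

Program Definition inv2_vcomp {a b} (f g h : B a b) (β : inv2 g h) (α : inv2 f g) :
  inv2 f h :=
  {| fwd := fwd β • fwd α; bwd := bwd α • bwd β |}.
Next Obligation.
  rewrite (bc_assoc HB), <- (bc_assoc HB (bwd α)), bwd_fwd, (bc_idr HB); apply bwd_fwd.
Qed.
Next Obligation.
  rewrite (bc_assoc HB), <- (bc_assoc HB (fwd β)), fwd_bwd, (bc_idr HB); apply fwd_bwd.
Qed.

Program Definition inv2_hcomp {a b c} (f f' : B a b) (g g' : B b c)
    (β : inv2 g g') (α : inv2 f f') : inv2 (g ⊙ f) (g' ⊙ f') :=
  {| fwd := fwd β ⊛ fwd α; bwd := bwd β ⊛ bwd α |}.
Next Obligation.
  rewrite <- (bc_interchange HB), !bwd_fwd; apply (bc_hcomp_id HB).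
Qed.
Next Obligation.
  rewrite <- (bc_interchange HB), !fwd_bwd; apply (bc_hcomp_id HB).
Qed.

Definition core : bicat_data Obj :=
  {| cell1 := B;
     cell2 := @inv2;
     id1 := id1 B;
     comp1 := @comp1 _ B;
     id2 := @inv2_id;
     vcomp2 := @inv2_vcomp;
     hcomp2 := @inv2_hcomp;
     lunit := fun _ _ f => Inv2 (bc_lunitK HB f) (bc_lunitVK HB f);
     lunit_inv := fun _ _ f => Inv2 (bc_lunitVK HB f) (bc_lunitK HB f);
     runit := fun _ _ f => Inv2 (bc_runitK HB f) (bc_runitVK HB f);
     runit_inv := fun _ _ f => Inv2 (bc_runitVK HB f) (bc_runitK HB f);
     associ := fun _ _ _ _ h g f => Inv2 (bc_associK HB h g f) (bc_associVK HB h g f);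
     associ_inv := fun _ _ _ _ h g f =>
       Inv2 (bc_associVK HB h g f) (bc_associK HB h g f) |}.

End Core.

(** [squ h v v' h'] is the class of squares with top [h], left side [v], right side [v']
    and bottom [h'].  With ⋆ for the actions of 2-morphisms on squares:
    [act_top α S] is α ⋆_H S, [act_bot S α] is S ⋆_H α,
    [act_left α S] is α ⋆_V S, [act_right S α] is S ⋆_V α. *)
Record verity_data := VerityData {
  vd_ob : Type;
  hor : bicat_data vd_ob;
  ver : bicat_data vd_ob;
  squ : forall a b c d : vd_ob, hor a b -> ver a c -> ver b d -> hor c d -> Type;
  sq_hcomp : forall a b c a' b' c' (f : hor a b) (g : hor b c)
      (v : ver a a') (v' : ver b b') (v'' : ver c c') (f' : hor a' b') (g' : hor b' c'),
    squ f v v' f' -> squ g v' v'' g' -> squ (g ⊙ f) v v'' (g' ⊙ f');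
  sq_vcomp : forall a b a' b' a'' b'' (f : hor a b) (v : ver a a') (w : ver b b')
      (f' : hor a' b') (v' : ver a' a'') (w' : ver b' b'') (f'' : hor a'' b''),
    squ f v w f' -> squ f' v' w' f'' -> squ f (v' ⊙ v) (w' ⊙ w) f'';
  sq_hunit : forall x y (v : ver x y), squ (id1 hor x) v v (id1 hor y);
  sq_vunit : forall x y (h : hor x y), squ h (id1 ver x) (id1 ver y) h;
  act_top : forall a b c d (k h : hor a b) (v : ver a c) (v' : ver b d) (h' : hor c d),
    k ⇒ h -> squ h v v' h' -> squ k v v' h';
  act_bot : forall a b c d (h : hor a b) (v : ver a c) (v' : ver b d) (h' k : hor c d),
    squ h v v' h' -> h' ⇒ k -> squ h v v' k;
  act_left : forall a b c d (h : hor a b) (w v : ver a c) (v' : ver b d) (h' : hor c d),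
    w ⇒ v -> squ h v v' h' -> squ h w v' h';
  act_right : forall a b c d (h : hor a b) (v : ver a c) (v' w : ver b d) (h' : hor c d),
    squ h v v' h' -> v' ⇒ w -> squ h v w h'
}.
Arguments sq_hunit {_ _ _} _.
Arguments sq_vunit {_ _ _} _.

Declare Scope squ_scope.
Delimit Scope squ_scope with squ.
Local Open Scope squ_scope.
Notation "F ⊗H G" := (sq_hcomp F G) (at level 50, left associativity) : squ_scope.
Notation "F ⊗V G" := (sq_vcomp F G) (at level 50, left associativity) : squ_scope.

Record is_verity_double_bicategory (V : verity_data) : Prop := {
  vd_hor_bicat : is_bicategory (hor V);
  vd_ver_bicat : is_bicategory (ver V);

  vd_interchange : forall a b c a' b' c' a'' b'' c''
      (f : hor V a b) (g : hor V b c) (f' : hor V a' b') (g' : hor V b' c')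
      (f'' : hor V a'' b'') (g'' : hor V b'' c'')
      (u : ver V a a') (v : ver V b b') (w : ver V c c')
      (u' : ver V a' a'') (v' : ver V b' b'') (w' : ver V c' c'')
      (F : squ f u v f') (F' : squ f' u' v' f'')
      (G : squ g v w g') (G' : squ g' v' w' g''),
    (F ⊗V F') ⊗H (G ⊗V G') = (F ⊗H G) ⊗V (F' ⊗H G');

  (* the four maps are actions of the 2-morphisms under vertical composition *)
  vd_top_id : forall a b c d (h : hor V a b) (v : ver V a c) (v' : ver V b d)
      (h' : hor V c d) (S : squ h v v' h'),
    act_top (id2 _ h) S = S;
  vd_bot_id : forall a b c d (h : hor V a b) (v : ver V a c) (v' : ver V b d)
      (h' : hor V c d) (S : squ h v v' h'),
    act_bot S (id2 _ h') = S;
  vd_left_id : forall a b c d (h : hor V a b) (v : ver V a c) (v' : ver V b d)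
      (h' : hor V c d) (S : squ h v v' h'),
    act_left (id2 _ v) S = S;
  vd_right_id : forall a b c d (h : hor V a b) (v : ver V a c) (v' : ver V b d)
      (h' : hor V c d) (S : squ h v v' h'),
    act_right S (id2 _ v') = S;
  vd_top_comp : forall a b c d (l k h : hor V a b) (v : ver V a c) (v' : ver V b d)
      (h' : hor V c d) (β : k ⇒ h) (α : l ⇒ k) (S : squ h v v' h'),
    act_top (β • α) S = act_top α (act_top β S);
  vd_bot_comp : forall a b c d (h : hor V a b) (v : ver V a c) (v' : ver V b d)
      (h' k l : hor V c d) (β : k ⇒ l) (α : h' ⇒ k) (S : squ h v v' h'),
    act_bot S (β • α) = act_bot (act_bot S α) β;
  vd_left_comp : forall a b c d (h : hor V a b) (x w v : ver V a c) (v' : ver V b d)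
      (h' : hor V c d) (β : w ⇒ v) (α : x ⇒ w) (S : squ h v v' h'),
    act_left (β • α) S = act_left α (act_left β S);
  vd_right_comp : forall a b c d (h : hor V a b) (v : ver V a c) (v' w x : ver V b d)
      (h' : hor V c d) (β : w ⇒ x) (α : v' ⇒ w) (S : squ h v v' h'),
    act_right S (β • α) = act_right (act_right S α) β;

  (* (F ⊗_H F') ⋆_H (α * α') = (F ⋆_H α) ⊗_H (F' ⋆_H α') and its variants;
     the horizontal composite α * α' is [α' ⊛ α] *)
  vd_bot_hcomp : forall a b c a' b' c' (f : hor V a b) (g : hor V b c)
      (u : ver V a a') (v : ver V b b') (w : ver V c c')
      (f' k : hor V a' b') (g' l : hor V b' c')
      (F : squ f u v f') (F' : squ g v w g') (α : f' ⇒ k) (α' : g' ⇒ l),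
    act_bot (F ⊗H F') (α' ⊛ α) = act_bot F α ⊗H act_bot F' α';
  vd_top_hcomp : forall a b c a' b' c' (k f : hor V a b) (l g : hor V b c)
      (u : ver V a a') (v : ver V b b') (w : ver V c c')
      (f' : hor V a' b') (g' : hor V b' c')
      (F : squ f u v f') (F' : squ g v w g') (α : k ⇒ f) (α' : l ⇒ g),
    act_top (α' ⊛ α) (F ⊗H F') = act_top α F ⊗H act_top α' F';
  vd_right_vcomp : forall a b a' b' a'' b'' (f : hor V a b) (f' : hor V a' b')
      (f'' : hor V a'' b'') (u : ver V a a') (v x : ver V b b')
      (u' : ver V a' a'') (v' x' : ver V b' b'')
      (F : squ f u v f') (F' : squ f' u' v' f'') (α : v ⇒ x) (α' : v' ⇒ x'),
    act_right (F ⊗V F') (α' ⊛ α) = act_right F α ⊗V act_right F' α';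
  vd_left_vcomp : forall a b a' b' a'' b'' (f : hor V a b) (f' : hor V a' b')
      (f'' : hor V a'' b'') (x u : ver V a a') (v : ver V b b')
      (x' u' : ver V a' a'') (v' : ver V b' b'')
      (F : squ f u v f') (F' : squ f' u' v' f'') (α : x ⇒ u) (α' : x' ⇒ u'),
    act_left (α' ⊛ α) (F ⊗V F') = act_left α F ⊗V act_left α' F';

  (* (F ⊗_H G) ⋆_V α = F ⊗_H (G ⋆_V α) and its variants *)
  vd_right_hcomp : forall a b c a' b' c' (f : hor V a b) (g : hor V b c)
      (u : ver V a a') (v : ver V b b') (w x : ver V c c')
      (f' : hor V a' b') (g' : hor V b' c')
      (F : squ f u v f') (G : squ g v w g') (α : w ⇒ x),
    act_right (F ⊗H G) α = F ⊗H act_right G α;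
  vd_left_hcomp : forall a b c a' b' c' (f : hor V a b) (g : hor V b c)
      (x u : ver V a a') (v : ver V b b') (w : ver V c c')
      (f' : hor V a' b') (g' : hor V b' c')
      (F : squ f u v f') (G : squ g v w g') (α : x ⇒ u),
    act_left α (F ⊗H G) = act_left α F ⊗H G;
  vd_bot_vcomp : forall a b a' b' a'' b'' (f : hor V a b) (f' : hor V a' b')
      (f'' k : hor V a'' b'') (u : ver V a a') (v : ver V b b')
      (u' : ver V a' a'') (v' : ver V b' b'')
      (F : squ f u v f') (G : squ f' u' v' f'') (α : f'' ⇒ k),
    act_bot (F ⊗V G) α = F ⊗V act_bot G α;
  vd_top_vcomp : forall a b a' b' a'' b'' (k f : hor V a b) (f' : hor V a' b')
      (f'' : hor V a'' b'') (u : ver V a a') (v : ver V b b')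
      (u' : ver V a' a'') (v' : ver V b' b'')
      (F : squ f u v f') (G : squ f' u' v' f'') (α : k ⇒ f),
    act_top α (F ⊗V G) = act_top α F ⊗V G;

  (* α ⋆ (S ⋆ β) = (α ⋆ S) ⋆ β *)
  vd_top_bot : forall a b c d (k h : hor V a b) (v : ver V a c) (v' : ver V b d)
      (h' k' : hor V c d) (S : squ h v v' h') (α : k ⇒ h) (β : h' ⇒ k'),
    act_top α (act_bot S β) = act_bot (act_top α S) β;
  vd_left_right : forall a b c d (h : hor V a b) (w v : ver V a c) (v' w' : ver V b d)
      (h' : hor V c d) (S : squ h v v' h') (α : w ⇒ v) (β : v' ⇒ w'),
    act_left α (act_right S β) = act_right (act_left α S) β;

  vd_top_left : forall a b c d (k h : hor V a b) (w v : ver V a c) (v' : ver V b d)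
      (h' : hor V c d) (S : squ h v v' h') (α : k ⇒ h) (β : w ⇒ v),
    act_top α (act_left β S) = act_left β (act_top α S);
  vd_bot_right : forall a b c d (h : hor V a b) (v : ver V a c) (v' w : ver V b d)
      (h' k : hor V c d) (S : squ h v v' h') (α : h' ⇒ k) (β : v' ⇒ w),
    act_bot (act_right S β) α = act_right (act_bot S α) β;
  vd_top_right : forall a b c d (k h : hor V a b) (v : ver V a c) (v' w : ver V b d)
      (h' : hor V c d) (S : squ h v v' h') (α : k ⇒ h) (β : v' ⇒ w),
    act_top α (act_right S β) = act_right (act_top α S) β;
  vd_bot_left : forall a b c d (h : hor V a b) (w v : ver V a c) (v' : ver V b d)
      (h' k : hor V c d) (S : squ h v v' h') (α : h' ⇒ k) (β : w ⇒ v),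
    act_left β (act_bot S α) = act_bot (act_left β S) α;

  vd_hassoc : forall a b c d a' b' c' d'
      (f : hor V a b) (g : hor V b c) (h : hor V c d)
      (u : ver V a a') (v : ver V b b') (w : ver V c c') (x : ver V d d')
      (f' : hor V a' b') (g' : hor V b' c') (h' : hor V c' d')
      (F : squ f u v f') (G : squ g v w g') (H : squ h w x h'),
    act_top (associ _ h g f) ((F ⊗H G) ⊗H H)
    = act_bot (F ⊗H (G ⊗H H)) (associ _ h' g' f');
  vd_vassoc : forall a b c d a' b' c' d'
      (f : ver V a b) (g : ver V b c) (h : ver V c d)
      (u : hor V a a') (v : hor V b b') (w : hor V c c') (x : hor V d d')
      (f' : ver V a' b') (g' : ver V b' c') (h' : ver V c' d')
      (F : squ u f f' v) (G : squ v g g' w) (H : squ w h h' x),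
    act_left (associ _ h g f) ((F ⊗V G) ⊗V H)
    = act_right (F ⊗V (G ⊗V H)) (associ _ h' g' f');
  vd_hunit_r : forall a b c d (h : hor V a b) (g : ver V a c) (g' : ver V b d)
      (h' : hor V c d) (F : squ h g g' h'),
    act_bot (act_top (lunit_inv _ h) (F ⊗H sq_hunit g')) (lunit _ h') = F;
  vd_hunit_l : forall a b c d (h : hor V a b) (g : ver V a c) (g' : ver V b d)
      (h' : hor V c d) (F : squ h g g' h'),
    act_bot (act_top (runit_inv _ h) (sq_hunit g ⊗H F)) (runit _ h') = F;
  vd_vunit_b : forall a b c d (g : hor V a b) (v : ver V a c) (v' : ver V b d)
      (g' : hor V c d) (F : squ g v v' g'),
    act_right (act_left (lunit_inv _ v) (F ⊗V sq_vunit g')) (lunit _ v') = F;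
  vd_vunit_t : forall a b c d (g : hor V a b) (v : ver V a c) (v' : ver V b d)
      (g' : hor V c d) (F : squ g v v' g'),
    act_right (act_left (runit_inv _ v) (sq_vunit g ⊗V F)) (runit _ v') = F
}.

Record cospan {C : category} (X Y : C) := Cospan {
  apex : C;
  leg1 : hom X apex;
  leg2 : hom Y apex
}.
Arguments leg1 {_ _ _} _.
Arguments leg2 {_ _ _} _.

Record cospan_map {C : category} {X Y : C} (S T : cospan X Y) := CospanMap {
  cmap :> hom (apex S) (apex T);
  cmap_leg1 : cmap ∘ leg1 S = leg1 T;
  cmap_leg2 : cmap ∘ leg2 S = leg2 T
}.

(* Right-nested forms of the rewrite rules, for terms normalised by [<- comp_assoc]. *)
Section Rules.
Context {C : category}.

Lemma po_desc_inl_r {A B D : C} (f : hom A B) (g : hom A D) (p : pushout f g)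
    (Z : C) u v (e : u ∘ f = v ∘ g :> hom A Z) (W : C) (x : hom W B) :
  po_desc p u v e ∘ (po_inl p ∘ x) = u ∘ x.
Proof. now rewrite comp_assoc, po_desc_inl. Qed.

Lemma po_desc_inr_r {A B D : C} (f : hom A B) (g : hom A D) (p : pushout f g)
    (Z : C) u v (e : u ∘ f = v ∘ g :> hom A Z) (W : C) (x : hom W D) :
  po_desc p u v e ∘ (po_inr p ∘ x) = v ∘ x.
Proof. now rewrite comp_assoc, po_desc_inr. Qed.

Lemma cmap_leg1_r {X Y : C} (S T : cospan X Y) (α : cospan_map S T) (W : C) (x : hom W X) :
  α ∘ (leg1 S ∘ x) = leg1 T ∘ x.
Proof. now rewrite comp_assoc, cmap_leg1. Qed.

Lemma cmap_leg2_r {X Y : C} (S T : cospan X Y) (α : cospan_map S T) (W : C) (x : hom W Y) :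
  α ∘ (leg2 S ∘ x) = leg2 T ∘ x.
Proof. now rewrite comp_assoc, cmap_leg2. Qed.

Lemma po_comm_r {A B D : C} (f : hom A B) (g : hom A D) (p : pushout f g)
    (W : C) (x : hom W A) :
  po_inl p ∘ (f ∘ x) = po_inr p ∘ (g ∘ x).
Proof. now rewrite !comp_assoc, po_comm. Qed.

Lemma cospan_map_eq {X Y : C} (S T : cospan X Y) (α β : cospan_map S T) :
  cmap α = cmap β -> α = β.
Proof.
  destruct α as [a a1 a2], β as [b b1 b2]; simpl; intros <-.
  f_equal; apply proof_irrelevance.
Qed.

End Rules.

Ltac cat_norm :=
  simpl; repeat rewrite <- comp_assoc;
  repeat (first
    [ rewrite comp_idl | rewrite comp_idr
    | rewrite po_desc_inl | rewrite po_desc_inr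
    | rewrite po_desc_inl_r | rewrite po_desc_inr_r
    | rewrite cmap_leg1 | rewrite cmap_leg2
    | rewrite cmap_leg1_r | rewrite cmap_leg2_r
    | rewrite po_comm | rewrite po_comm_r ];
    repeat rewrite <- comp_assoc).

Ltac cat_solve := cat_norm; reflexivity.
Ltac po_solve := cat_norm; repeat (apply po_ext; cat_norm); reflexivity.

Section Cosp.
Context {C : category} (P : chosen_pushouts C).

Definition cospan_id (X : C) : cospan X X :=
  {| apex := X; leg1 := idm X; leg2 := idm X |}.

Definition cospan_comp {X Y Z : C} (T : cospan Y Z) (S : cospan X Y) : cospan X Z :=
  {| apex := po_ob (P (leg2 S) (leg1 T));
     leg1 := po_inl (P (leg2 S) (leg1 T)) ∘ leg1 S;
     leg2 := po_inr (P (leg2 S) (leg1 T)) ∘ leg2 T |}.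

Program Definition cmap_id {X Y : C} (S : cospan X Y) : cospan_map S S :=
  {| cmap := idm (apex S) |}.
Solve Obligations with intros; cat_solve.

Program Definition cmap_vcomp {X Y : C} (S T U : cospan X Y)
    (β : cospan_map T U) (α : cospan_map S T) : cospan_map S U :=
  {| cmap := β ∘ α |}.
Solve Obligations with intros; cat_solve.

Program Definition cmap_hcomp {X Y Z : C} (S S' : cospan X Y) (T T' : cospan Y Z)
    (β : cospan_map T T') (α : cospan_map S S') :
  cospan_map (cospan_comp T S) (cospan_comp T' S') :=
  {| cmap := po_desc (P (leg2 S) (leg1 T))
               (po_inl (P (leg2 S') (leg1 T')) ∘ α) (po_inr (P (leg2 S') (leg1 T')) ∘ β) _ |}.
Solve Obligations with intros; cat_solve.

Program Definition cmap_lunit {X Y : C} (S : cospan X Y) :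
  cospan_map (cospan_comp (cospan_id Y) S) S :=
  {| cmap := po_desc (P (leg2 S) (idm Y)) (idm (apex S)) (leg2 S) _ |}.
Solve Obligations with intros; cat_solve.

Program Definition cmap_lunit_inv {X Y : C} (S : cospan X Y) :
  cospan_map S (cospan_comp (cospan_id Y) S) :=
  {| cmap := po_inl (P (leg2 S) (idm Y)) |}.
Solve Obligations with intros; cat_solve.

Program Definition cmap_runit {X Y : C} (S : cospan X Y) :
  cospan_map (cospan_comp S (cospan_id X)) S :=
  {| cmap := po_desc (P (idm X) (leg1 S)) (leg1 S) (idm (apex S)) _ |}.
Solve Obligations with intros; cat_solve.

Program Definition cmap_runit_inv {X Y : C} (S : cospan X Y) :
  cospan_map S (cospan_comp S (cospan_id X)) :=
  {| cmap := po_inr (P (idm X) (leg1 S)) |}.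
Next Obligation. rewrite <- po_comm; reflexivity. Qed.

Program Definition cmap_associ {W X Y Z : C}
    (U : cospan Y Z) (T : cospan X Y) (S : cospan W X) :
  cospan_map (cospan_comp (cospan_comp U T) S) (cospan_comp U (cospan_comp T S)) :=
  {| cmap := po_desc (P (leg2 S) (leg1 (cospan_comp U T)))
       (po_inl (P (leg2 (cospan_comp T S)) (leg1 U)) ∘ po_inl (P (leg2 S) (leg1 T)))
       (po_desc (P (leg2 T) (leg1 U))
          (po_inl (P (leg2 (cospan_comp T S)) (leg1 U)) ∘ po_inr (P (leg2 S) (leg1 T)))
          (po_inr (P (leg2 (cospan_comp T S)) (leg1 U)))
          _)
       _ |}.
Solve Obligations with intros; cat_solve.

Program Definition cmap_associ_inv {W X Y Z : C}
    (U : cospan Y Z) (T : cospan X Y) (S : cospan W X) :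
  cospan_map (cospan_comp U (cospan_comp T S)) (cospan_comp (cospan_comp U T) S) :=
  {| cmap := po_desc (P (leg2 (cospan_comp T S)) (leg1 U))
       (po_desc (P (leg2 S) (leg1 T))
          (po_inl (P (leg2 S) (leg1 (cospan_comp U T))))
          (po_inr (P (leg2 S) (leg1 (cospan_comp U T))) ∘ po_inl (P (leg2 T) (leg1 U)))
          _)
       (po_inr (P (leg2 S) (leg1 (cospan_comp U T))) ∘ po_inr (P (leg2 T) (leg1 U)))
       _ |}.
Solve Obligations with intros; cat_solve.

Definition cosp : bicat_data C :=
  {| cell1 := @cospan C;
     cell2 := @cospan_map C;
     id1 := cospan_id;
     comp1 := @cospan_comp;
     id2 := @cmap_id;
     vcomp2 := @cmap_vcomp;
     hcomp2 := @cmap_hcomp;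
     lunit := @cmap_lunit;
     lunit_inv := @cmap_lunit_inv;
     runit := @cmap_runit;
     runit_inv := @cmap_runit_inv;
     associ := @cmap_associ;
     associ_inv := @cmap_associ_inv |}.

Lemma cosp_is_bicategory : is_bicategory cosp.
Proof.
  constructor; simpl; intros; apply cospan_map_eq.
  all: try solve [po_solve].
  all: cat_norm.
  all: repeat (apply po_ext; cat_norm).
  - rewrite <- po_comm; apply comp_idr.
  - reflexivity.
Qed.

End Cosp.

Definition inv_cosp {C : category} (P : chosen_pushouts C) : bicat_data C :=
  core (cosp_is_bicategory P).

Definition classes {T : Type} (R : T -> T -> Prop) : Type :=
  {K : T -> Prop | exists t, K = R t}.

Definition class_of {T} (R : T -> T -> Prop) (t : T) : classes R :=
  exist _ (R t) (ex_intro _ t eq_refl).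

Lemma classes_ext {T} (R : T -> T -> Prop) (K L : classes R) :
  (forall t, proj1_sig K t <-> proj1_sig L t) -> K = L.
Proof.
  destruct K as [K HK], L as [L HL]; simpl; intros H.
  assert (e : K = L) by (apply functional_extensionality; intro t;
                         apply propositional_extensionality; apply H).
  subst L; f_equal; apply proof_irrelevance.
Qed.

Section Quotient.
Context {T U V : Type} {R : T -> T -> Prop} {Q : U -> U -> Prop} {S : V -> V -> Prop}.
Context {ER : Equivalence R} {EQ : Equivalence Q} {ES : Equivalence S}.

Lemma class_of_eq (t u : T) : class_of R t = class_of R u <-> R t u.
Proof.
  split; intro H.
  - apply (f_equal (fun K => proj1_sig K u)) in H; simpl in H; rewrite H; reflexivity.
  - apply classes_ext; intro x; simpl; split; intro Hx;
      etransitivity; eauto; symmetry; assumption.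
Qed.

Program Definition class_map (f : T -> V) (Hf : forall t t', R t t' -> S (f t) (f t'))
    (K : classes R) : classes S :=
  exist _ (fun x => exists t, proj1_sig K t /\ S (f t) x) _.
Next Obligation.
  destruct K as [K [t ->]]; exists (f t); simpl.
  apply functional_extensionality; intro x; apply propositional_extensionality; split.
  - intros [t' [Ht Hx]]; etransitivity; eauto.
  - intro Hx; exists t; split; [reflexivity|assumption].
Qed.

Program Definition class_map2 (f : T -> U -> V)
    (Hf : forall t t' u u', R t t' -> Q u u' -> S (f t u) (f t' u'))
    (K : classes R) (L : classes Q) : classes S :=
  exist _ (fun x => exists t u, proj1_sig K t /\ proj1_sig L u /\ S (f t u) x) _.
Next Obligation.
  destruct K as [K [t ->]], L as [L [u ->]]; exists (f t u); simpl.
  apply functional_extensionality; intro x; apply propositional_extensionality; split.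
  - intros [t' [u' [Ht [Hu Hx]]]]; etransitivity; eauto.
  - intro Hx; exists t, u; repeat split; [reflexivity|reflexivity|assumption].
Qed.

Lemma class_map_of f Hf (t : T) : @class_map f Hf (class_of R t) = class_of S (f t).
Proof.
  apply classes_ext; intro x; simpl; split.
  - intros [t' [Ht Hx]]; etransitivity; eauto.
  - intro Hx; exists t; split; [reflexivity|assumption].
Qed.

Lemma class_map2_of f Hf (t : T) (u : U) :
  @class_map2 f Hf (class_of R t) (class_of Q u) = class_of S (f t u).
Proof.
  apply classes_ext; intro x; simpl; split.
  - intros [t' [u' [Ht [Hu Hx]]]]; etransitivity; eauto.
  - intro Hx; exists t, u; repeat split; [reflexivity|reflexivity|assumption].
Qed.

End Quotient.

Section DoubleCospans.
Context {C : category} (P : chosen_pushouts C).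

(** The maps from the four corners of the boundary to the middle object are the
    composites along the sides, so only the maps from the four apexes are recorded. *)
Record diagram {X Y X' Y' : C} (h : cospan X Y) (v : cospan X X') (v' : cospan Y Y')
    (h' : cospan X' Y') := Diagram {
  mid : C;
  d_top : hom (apex h) mid;
  d_left : hom (apex v) mid;
  d_right : hom (apex v') mid;
  d_bot : hom (apex h') mid;
  d_top_left : d_top ∘ leg1 h = d_left ∘ leg1 v;
  d_top_right : d_top ∘ leg2 h = d_right ∘ leg1 v';
  d_bot_left : d_bot ∘ leg1 h' = d_left ∘ leg2 v;
  d_bot_right : d_bot ∘ leg2 h' = d_right ∘ leg2 v'
}.

Definition diagram_iso {X Y X' Y' : C} {h : cospan X Y} {v : cospan X X'}
    {v' : cospan Y Y'} {h' : cospan X' Y'} (F G : diagram h v v' h') : Prop :=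
  exists (i : hom (mid F) (mid G)) (j : hom (mid G) (mid F)),
    (j ∘ i = idm _ /\ i ∘ j = idm _) /\
    i ∘ d_top F = d_top G /\ i ∘ d_left F = d_left G /\
    i ∘ d_right F = d_right G /\ i ∘ d_bot F = d_bot G.

#[global] Instance diagram_iso_equiv {X Y X' Y' : C} (h : cospan X Y) (v : cospan X X')
    (v' : cospan Y Y') (h' : cospan X' Y') : Equivalence (@diagram_iso _ _ _ _ h v v' h').
Proof.
  split.
  - intro F; exists (idm _), (idm _); rewrite !comp_idl; repeat split.
  - intros F G (i & j & (ji & ij) & t & l & r & b); exists j, i.
    repeat split; auto.
    all: rewrite <- ?t, <- ?l, <- ?r, <- ?b, comp_assoc, ji; apply comp_idl.
  - intros F G H (i & j & (ji & ij) & t & l & r & b) (i' & j' & (ji' & ij') & t' & l' & r' & b').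
    exists (i' ∘ i), (j ∘ j'); repeat split.
    + rewrite <- comp_assoc, (comp_assoc j'), ji', comp_idl; exact ji.
    + rewrite <- comp_assoc, (comp_assoc i), ij, comp_idl; exact ij'.
    + rewrite <- comp_assoc, t; exact t'.
    + rewrite <- comp_assoc, l; exact l'.
    + rewrite <- comp_assoc, r; exact r'.
    + rewrite <- comp_assoc, b; exact b'.
Qed.

(** Reflection in the main diagonal; it turns the horizontal operations into the
    vertical ones. *)
Definition transpose {X Y X' Y' : C} (h : cospan X Y) (v : cospan X X')
    (v' : cospan Y Y') (h' : cospan X' Y') (F : diagram h v v' h') : diagram v h h' v' :=
  {| mid := mid F;
     d_top := d_left F; d_left := d_top F; d_right := d_bot F; d_bot := d_right F;
     d_top_left := eq_sym (d_top_left F);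
     d_top_right := eq_sym (d_bot_left F);
     d_bot_left := eq_sym (d_top_right F);
     d_bot_right := eq_sym (d_bot_right F) |}.

Program Definition diagram_hcomp {X Y Z X' Y' Z' : C} (f : cospan X Y) (g : cospan Y Z)
    (v : cospan X X') (v' : cospan Y Y') (v'' : cospan Z Z')
    (f' : cospan X' Y') (g' : cospan Y' Z')
    (F : diagram f v v' f') (G : diagram g v' v'' g') :
  diagram (cospan_comp P g f) v v'' (cospan_comp P g' f') :=
  let p := P (d_right F) (d_left G) in
  {| mid := po_ob p;
     d_top := po_desc (P (leg2 f) (leg1 g)) (po_inl p ∘ d_top F) (po_inr p ∘ d_top G) _;
     d_left := po_inl p ∘ d_left F;
     d_right := po_inr p ∘ d_right G;
     d_bot := po_desc (P (leg2 f') (leg1 g')) (po_inl p ∘ d_bot F) (po_inr p ∘ d_bot G) _ |}.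
Next Obligation.
  now rewrite <- !comp_assoc, d_top_right, d_top_left, !comp_assoc, po_comm.
Qed.
Next Obligation.
  now rewrite <- !comp_assoc, d_bot_right, d_bot_left, !comp_assoc, po_comm.
Qed.
Next Obligation. now rewrite comp_assoc, po_desc_inl, <- !comp_assoc, d_top_left. Qed.
Next Obligation. now rewrite comp_assoc, po_desc_inr, <- !comp_assoc, d_top_right. Qed.
Next Obligation. now rewrite comp_assoc, po_desc_inl, <- !comp_assoc, d_bot_left. Qed.
Next Obligation. now rewrite comp_assoc, po_desc_inr, <- !comp_assoc, d_bot_right. Qed.

Definition diagram_vcomp {X Y X' Y' X'' Y'' : C} (f : cospan X Y) (v : cospan X X')
    (w : cospan Y Y') (f' : cospan X' Y') (v' : cospan X' X'') (w' : cospan Y' Y'')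
    (f'' : cospan X'' Y'') (F : diagram f v w f') (G : diagram f' v' w' f'') :
  diagram f (cospan_comp P v' v) (cospan_comp P w' w) f'' :=
  transpose (diagram_hcomp (transpose F) (transpose G)).

Definition diagram_hunit {X Y : C} (v : cospan X Y) :
  diagram (cospan_id X) v v (cospan_id Y) :=
  let e (W : C) (u : hom W (apex v)) : u ∘ idm W = idm (apex v) ∘ u :=
    eq_trans (comp_idr u) (eq_sym (comp_idl u)) in
  @Diagram X X Y Y (cospan_id X) v v (cospan_id Y) (apex v)
    (leg1 v) (idm (apex v)) (idm (apex v)) (leg2 v)
    (e X (leg1 v)) (e X (leg1 v)) (e Y (leg2 v)) (e Y (leg2 v)).

Definition diagram_vunit {X Y : C} (h : cospan X Y) :
  diagram h (cospan_id X) (cospan_id Y) h :=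
  transpose (diagram_hunit h).

Program Definition diagram_top {X Y X' Y' : C} (k h : cospan X Y) (v : cospan X X')
    (v' : cospan Y Y') (h' : cospan X' Y') (α : cospan_map k h) (F : diagram h v v' h') :
  diagram k v v' h' :=
  {| mid := mid F;
     d_top := d_top F ∘ α; d_left := d_left F; d_right := d_right F; d_bot := d_bot F;
     d_bot_left := d_bot_left F; d_bot_right := d_bot_right F |}.
Next Obligation. rewrite <- comp_assoc, cmap_leg1; apply d_top_left. Qed.
Next Obligation. rewrite <- comp_assoc, cmap_leg2; apply d_top_right. Qed.

Program Definition diagram_bot {X Y X' Y' : C} (h : cospan X Y) (v : cospan X X')
    (v' : cospan Y Y') (h' k : cospan X' Y') (F : diagram h v v' h') (α : cospan_map k h') :
  diagram h v v' k :=
  {| mid := mid F;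
     d_top := d_top F; d_left := d_left F; d_right := d_right F; d_bot := d_bot F ∘ α;
     d_top_left := d_top_left F; d_top_right := d_top_right F |}.
Next Obligation. rewrite <- comp_assoc, cmap_leg1; apply d_bot_left. Qed.
Next Obligation. rewrite <- comp_assoc, cmap_leg2; apply d_bot_right. Qed.

Definition diagram_left {X Y X' Y' : C} (h : cospan X Y) (w v : cospan X X')
    (v' : cospan Y Y') (h' : cospan X' Y') (α : cospan_map w v) (F : diagram h v v' h') :
  diagram h w v' h' :=
  transpose (diagram_top α (transpose F)).

Definition diagram_right {X Y X' Y' : C} (h : cospan X Y) (v : cospan X X')
    (v' w : cospan Y Y') (h' : cospan X' Y') (F : diagram h v v' h') (α : cospan_map w v') :
  diagram h v w h' :=
  transpose (diagram_bot (transpose F) α).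

Lemma transpose_iso {X Y X' Y' : C} (h : cospan X Y) (v : cospan X X')
    (v' : cospan Y Y') (h' : cospan X' Y') (F G : diagram h v v' h') :
  diagram_iso F G -> diagram_iso (transpose F) (transpose G).
Proof.
  intros (i & j & ij & t & l & r & b); exists i, j; repeat split; auto; apply ij.
Qed.

Lemma diagram_hcomp_iso {X Y Z X' Y' Z' : C} (f : cospan X Y) (g : cospan Y Z)
    (v : cospan X X') (v' : cospan Y Y') (v'' : cospan Z Z')
    (f' : cospan X' Y') (g' : cospan Y' Z')
    (F F1 : diagram f v v' f') (G G1 : diagram g v' v'' g') :
  diagram_iso F F1 -> diagram_iso G G1 ->
  diagram_iso (diagram_hcomp F G) (diagram_hcomp F1 G1).
Proof.
  intros (i & j & (ji & ij) & t & l & r & b) (i' & j' & (ji' & ij') & t' & l' & r' & b').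
  assert (rj : j ∘ d_right F1 = d_right F) by (rewrite <- r, comp_assoc, ji; apply comp_idl).
  assert (lj : j' ∘ d_left G1 = d_left G) by (rewrite <- l', comp_assoc, ji'; apply comp_idl).
  set (p := P (d_right F) (d_left G)).
  set (q := P (d_right F1) (d_left G1)).
  assert (e : (po_inl q ∘ i) ∘ d_right F = (po_inr q ∘ i') ∘ d_left G)
    by (rewrite <- !comp_assoc, r, l'; apply po_comm).
  assert (e' : (po_inl p ∘ j) ∘ d_right F1 = (po_inr p ∘ j') ∘ d_left G1)
    by (rewrite <- !comp_assoc, rj, lj; apply po_comm).
  exists (po_desc p _ _ e), (po_desc q _ _ e'); repeat split.
  - simpl; fold p; apply po_ext; cat_norm; rewrite ?ji, ?ji'; apply comp_idr.
  - simpl; fold q; apply po_ext; cat_norm; rewrite ?ij, ?ij'; apply comp_idr.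
  - simpl; fold p q; apply po_ext; cat_norm; rewrite ?t, ?t'; reflexivity.
  - simpl; fold p q; cat_norm; rewrite l; reflexivity.
  - simpl; fold p q; cat_norm; rewrite r'; reflexivity.
  - simpl; fold p q; apply po_ext; cat_norm; rewrite ?b, ?b'; reflexivity.
Qed.

Lemma diagram_vcomp_iso {X Y X' Y' X'' Y'' : C} (f : cospan X Y) (v : cospan X X')
    (w : cospan Y Y') (f' : cospan X' Y') (v' : cospan X' X'') (w' : cospan Y' Y'')
    (f'' : cospan X'' Y'') (F F1 : diagram f v w f') (G G1 : diagram f' v' w' f'') :
  diagram_iso F F1 -> diagram_iso G G1 ->
  diagram_iso (diagram_vcomp F G) (diagram_vcomp F1 G1).
Proof. intros; apply transpose_iso, diagram_hcomp_iso; apply transpose_iso; assumption. Qed.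

Lemma diagram_top_iso {X Y X' Y' : C} (k h : cospan X Y) (v : cospan X X')
    (v' : cospan Y Y') (h' : cospan X' Y') (α : cospan_map k h) (F G : diagram h v v' h') :
  diagram_iso F G -> diagram_iso (diagram_top α F) (diagram_top α G).
Proof.
  intros (i & j & ij & t & l & r & b); exists i, j; repeat split; auto; try apply ij.
  simpl; rewrite comp_assoc, t; reflexivity.
Qed.

Lemma diagram_bot_iso {X Y X' Y' : C} (h : cospan X Y) (v : cospan X X')
    (v' : cospan Y Y') (h' k : cospan X' Y') (α : cospan_map k h') (F G : diagram h v v' h') :
  diagram_iso F G -> diagram_iso (diagram_bot F α) (diagram_bot G α).
Proof.
  intros (i & j & ij & t & l & r & b); exists i, j; repeat split; auto; try apply ij.
  simpl; rewrite comp_assoc, b; reflexivity.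
Qed.

Lemma diagram_left_iso {X Y X' Y' : C} (h : cospan X Y) (w v : cospan X X')
    (v' : cospan Y Y') (h' : cospan X' Y') (α : cospan_map w v) (F G : diagram h v v' h') :
  diagram_iso F G -> diagram_iso (diagram_left α F) (diagram_left α G).
Proof. intros; apply transpose_iso, diagram_top_iso, transpose_iso; assumption. Qed.

Lemma diagram_right_iso {X Y X' Y' : C} (h : cospan X Y) (v : cospan X X')
    (v' w : cospan Y Y') (h' : cospan X' Y') (α : cospan_map w v') (F G : diagram h v v' h') :
  diagram_iso F G -> diagram_iso (diagram_right F α) (diagram_right G α).
Proof. intros; apply transpose_iso, diagram_bot_iso, transpose_iso; assumption. Qed.

Definition diagram_class {X Y X' Y' : C} (h : cospan X Y) (v : cospan X X')
    (v' : cospan Y Y') (h' : cospan X' Y') : Type :=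
  classes (@diagram_iso _ _ _ _ h v v' h').

(** A 2-morphism acts on a top or left side it maps into by composing with the
    underlying cospan map, and on a right or bottom side it maps out of by composing with
    the inverse. *)
Definition two_cosp : verity_data :=
  {| vd_ob := C;
     hor := inv_cosp P;
     ver := inv_cosp P;
     squ := @diagram_class;
     sq_hcomp := fun _ _ _ _ _ _ f g v v' v'' f' g' =>
       class_map2 (@diagram_hcomp_iso _ _ _ _ _ _ f g v v' v'' f' g');
     sq_vcomp := fun _ _ _ _ _ _ f v w f' v' w' f'' =>
       class_map2 (@diagram_vcomp_iso _ _ _ _ _ _ f v w f' v' w' f'');
     sq_hunit := fun _ _ v => class_of diagram_iso (diagram_hunit v);
     sq_vunit := fun _ _ h => class_of diagram_iso (diagram_vunit h);
     act_top := fun _ _ _ _ k h v v' h' (α : @inv2 _ (cosp P) _ _ k h) F =>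
       class_map (@diagram_top_iso _ _ _ _ k h v v' h' (fwd α)) F;
     act_bot := fun _ _ _ _ h v v' h' k F (α : @inv2 _ (cosp P) _ _ h' k) =>
       class_map (@diagram_bot_iso _ _ _ _ h v v' h' k (bwd α)) F;
     act_left := fun _ _ _ _ h w v v' h' (α : @inv2 _ (cosp P) _ _ w v) F =>
       class_map (@diagram_left_iso _ _ _ _ h w v v' h' (fwd α)) F;
     act_right := fun _ _ _ _ h v v' w h' F (α : @inv2 _ (cosp P) _ _ v' w) =>
       class_map (@diagram_right_iso _ _ _ _ h v v' w h' (bwd α)) F |}.

End DoubleCospans.

(* Main.v *)
Require Import Defs.

Set Implicit Arguments.
Unset Strict Implicit.
Unset Printing Implicit Defensive.

Local Open Scope cat_scope.
Local Open Scope bicat_scope.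

(** Reading a diagram through its middle row [T_X -> M <- T_Y] makes horizontal composition
    of squares the composition of cospans of middle rows, so the associator and the unitors
    of Cosp(C) supply the isomorphisms of middle objects in the horizontal coherence laws;
    the vertical laws follow by transposing.  The interchange law says that the pushout of
    the pushouts of the rows of a 3 x 3 diagram agrees with that of its columns.  In all
    laws about the actions alone both sides have the same middle object. *)

Section CoreBicategory.
Context {Obj : Type} (B : bicat_data Obj) (HB : is_bicategory B).

(** Two-sided inverses are unique, so the backward cells agree as well. This reduces each equation
    between 2-cells of the core to one in [B]. *)
Lemma inv2_eq (a b : Obj) (f g : B a b) (α β : inv2 f g) : fwd α = fwd β -> α = β.
Proof.
  intro e; assert (e' : bwd α = bwd β).
  { rewrite <- (bc_idr HB (bwd α)), <- (fwd_bwd β), <- e, (bc_assoc HB), bwd_fwd.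
    apply (bc_idl HB). }
  destruct α as [s s' p q], β as [t t' p' q']; simpl in *; subst.
  f_equal; apply ProofIrrelevance.proof_irrelevance.
Qed.

Lemma core_is_bicategory : is_bicategory (core HB).
Proof. constructor; intros; apply inv2_eq; apply HB. Qed.

End CoreBicategory.

Section DiagramLaws.
Context {C : category} (P : chosen_pushouts C).

(** A strict equality, since [eq_sym] is involutive; double transposes can therefore be cancelled by
    rewriting. *)
Lemma transposeK (X Y X' Y' : C) (h : cospan X Y) (v : cospan X X')
    (v' : cospan Y Y') (h' : cospan X' Y') (F : diagram h v v' h') :
  transpose (transpose F) = F.
Proof.
  destruct F; unfold transpose; simpl; now rewrite !eq_sym_involutive.
Qed.

Definition middle (X Y X' Y' : C) (h : cospan X Y) (v : cospan X X')
    (v' : cospan Y Y') (h' : cospan X' Y') (F : diagram h v v' h') :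
  cospan (apex v) (apex v') :=
  {| apex := mid F; leg1 := d_left F; leg2 := d_right F |}.

(** The maps from the left and right apexes are the legs of the middle row, which a cospan map
    respects; only top and bottom remain to be checked. *)
Lemma middle_iso (X Y X' Y' : C) (h : cospan X Y) (v : cospan X X')
    (v' : cospan Y Y') (h' : cospan X' Y') (F G : diagram h v v' h')
    (α : inv2 (B := cosp P) (middle F) (middle G)) :
  fwd α ∘ d_top F = d_top G -> fwd α ∘ d_bot F = d_bot G -> diagram_iso F G.
Proof.
  intros et eb; exists (fwd α), (bwd α); repeat split; auto.
  - exact (f_equal (@cmap _ _ _ _ _) (bwd_fwd α)).
  - exact (f_equal (@cmap _ _ _ _ _) (fwd_bwd α)).
  - exact (cmap_leg1 (fwd α)).
  - exact (cmap_leg2 (fwd α)).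
Qed.

Lemma diagram_hassoc (a b c d a' b' c' d' : C)
    (f : cospan a b) (g : cospan b c) (h : cospan c d)
    (u : cospan a a') (v : cospan b b') (w : cospan c c') (x : cospan d d')
    (f' : cospan a' b') (g' : cospan b' c') (h' : cospan c' d')
    (F : diagram f u v f') (G : diagram g v w g') (H : diagram h w x h') :
  diagram_iso
    (diagram_top (cmap_associ P h g f) (diagram_hcomp P (diagram_hcomp P F G) H))
    (diagram_bot (diagram_hcomp P F (diagram_hcomp P G H)) (cmap_associ_inv P h' g' f')).
Proof.
  (* Cospans compose right to left, so the associator of the middle rows starts at the bracketing
     [F ⊗H (G ⊗H H)], the right-hand side. *)
  symmetry.
  apply middle_iso with
    (α := @associ _ (inv_cosp P) _ _ _ _ (middle H) (middle G) (middle F));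
    po_solve.
Qed.

Lemma diagram_hunit_r (a b c d : C) (h : cospan a b) (g : cospan a c)
    (g' : cospan b d) (h' : cospan c d) (F : diagram h g g' h') :
  diagram_iso
    (diagram_bot (diagram_top (cmap_lunit_inv P h) (diagram_hcomp P F (diagram_hunit g')))
       (cmap_lunit_inv P h')) F.
Proof.
  (* The middle row of [diagram_hunit g'] is an identity cospan, composed after [middle F]; hence
     the left unitor. *)
  apply middle_iso with (α := @lunit _ (inv_cosp P) _ _ (middle F)); cat_solve.
Qed.

Lemma diagram_hunit_l (a b c d : C) (h : cospan a b) (g : cospan a c)
    (g' : cospan b d) (h' : cospan c d) (F : diagram h g g' h') :
  diagram_iso
    (diagram_bot (diagram_top (cmap_runit_inv P h) (diagram_hcomp P (diagram_hunit g) F))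
       (cmap_runit_inv P h')) F.
Proof.
  apply middle_iso with (α := @runit _ (inv_cosp P) _ _ (middle F)); cat_solve.
Qed.

Lemma diagram_vassoc (a b c d a' b' c' d' : C)
    (f : cospan a b) (g : cospan b c) (h : cospan c d)
    (u : cospan a a') (v : cospan b b') (w : cospan c c') (x : cospan d d')
    (f' : cospan a' b') (g' : cospan b' c') (h' : cospan c' d')
    (F : diagram u f f' v) (G : diagram v g g' w) (H : diagram w h h' x) :
  diagram_iso
    (diagram_left (cmap_associ P h g f) (diagram_vcomp P (diagram_vcomp P F G) H))
    (diagram_right (diagram_vcomp P F (diagram_vcomp P G H)) (cmap_associ_inv P h' g' f')).
Proof.
  apply transpose_iso; unfold diagram_vcomp; rewrite !transposeK; apply diagram_hassoc.
Qed.

Lemma diagram_vunit_b (a b c d : C) (g : cospan a b) (v : cospan a c)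
    (v' : cospan b d) (g' : cospan c d) (F : diagram g v v' g') :
  diagram_iso
    (diagram_right (diagram_left (cmap_lunit_inv P v) (diagram_vcomp P F (diagram_vunit g')))
       (cmap_lunit_inv P v')) F.
Proof.
  (* The second occurrence of [F] is the right-hand side; both sides are then transposes. *)
  rewrite <- (transposeK F) at 2; apply transpose_iso.
  unfold diagram_left, diagram_vcomp, diagram_vunit; rewrite !transposeK.
  apply diagram_hunit_r.
Qed.

Lemma diagram_vunit_t (a b c d : C) (g : cospan a b) (v : cospan a c)
    (v' : cospan b d) (g' : cospan c d) (F : diagram g v v' g') :
  diagram_iso
    (diagram_right (diagram_left (cmap_runit_inv P v) (diagram_vcomp P (diagram_vunit g) F))
       (cmap_runit_inv P v')) F.
Proof.
  rewrite <- (transposeK F) at 2; apply transpose_iso.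
  unfold diagram_left, diagram_vcomp, diagram_vunit; rewrite !transposeK.
  apply diagram_hunit_l.
Qed.

(* The map from the pushout of pushouts of columns to that of rows; exchanging the two
   directions gives its inverse. *)
Lemma pushout_of_pushouts_map
    {z n s w e nw ne sw se : C}
    {zn : hom z n} {zs : hom z s} {zw : hom z w} {ze : hom z e}
    {n1 : hom n nw} {n2 : hom n ne} {s1 : hom s sw} {s2 : hom s se}
    {w1 : hom w nw} {w2 : hom w sw} {e1 : hom e ne} {e2 : hom e se}
    (pv : pushout zn zs) (ph : pushout zw ze)
    (pn : pushout n1 n2) (ps : pushout s1 s2) (pw : pushout w1 w2) (pe : pushout e1 e2)
    (a1 : hom (po_ob pv) (po_ob pw)) (a2 : hom (po_ob pv) (po_ob pe))
    (b1 : hom (po_ob ph) (po_ob pn)) (b2 : hom (po_ob ph) (po_ob ps))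
    (p : pushout a1 a2) (q : pushout b1 b2) :
  a1 ∘ po_inl pv = po_inl pw ∘ n1 -> a1 ∘ po_inr pv = po_inr pw ∘ s1 ->
  a2 ∘ po_inl pv = po_inl pe ∘ n2 -> a2 ∘ po_inr pv = po_inr pe ∘ s2 ->
  b1 ∘ po_inl ph = po_inl pn ∘ w1 -> b1 ∘ po_inr ph = po_inr pn ∘ e1 ->
  b2 ∘ po_inl ph = po_inl ps ∘ w2 -> b2 ∘ po_inr ph = po_inr ps ∘ e2 ->
  exists i : hom (po_ob p) (po_ob q),
    (i ∘ (po_inl p ∘ po_inl pw) = po_inl q ∘ po_inl pn /\
     i ∘ (po_inl p ∘ po_inr pw) = po_inr q ∘ po_inl ps) /\
    (i ∘ (po_inr p ∘ po_inl pe) = po_inl q ∘ po_inr pn /\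
     i ∘ (po_inr p ∘ po_inr pe) = po_inr q ∘ po_inr ps).
Proof.
  intros a1l a1r a2l a2r b1l b1r b2l b2r.
  (* The gluing conditions are asserted beforehand because rewriting would otherwise
     descend into the proof arguments of [po_desc]. *)
  assert (ew : (po_inl q ∘ po_inl pn) ∘ w1 = (po_inr q ∘ po_inl ps) ∘ w2)
    by now rewrite <- !comp_assoc, <- b1l, <- b2l, po_comm_r.
  assert (ee : (po_inl q ∘ po_inr pn) ∘ e1 = (po_inr q ∘ po_inr ps) ∘ e2)
    by now rewrite <- !comp_assoc, <- b1r, <- b2r, po_comm_r.
  assert (ea : po_desc pw _ _ ew ∘ a1 = po_desc pe _ _ ee ∘ a2).
  (* On the two legs of [pv] this is the commutativity of [pn] and of [ps]. *)
  { apply po_ext; rewrite <- !comp_assoc, ?a1l, ?a1r, ?a2l, ?a2r; cat_solve. }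
  exists (po_desc p _ _ ea); repeat split; cat_solve.
Qed.

(** Objects are named by compass points around the centre [z]; [pw], [pv], [pe] are the pushouts of
    the columns, [pn], [ph], [ps] those of the rows. Both composites of the two comparison maps fix
    the maps from the four corners, which are jointly epic. The arbitrary [k] fits the right-nested
    composites that [cat_norm] produces. *)
Lemma pushout_of_pushouts_iso
    {z n s w e nw ne sw se : C}
    {zn : hom z n} {zs : hom z s} {zw : hom z w} {ze : hom z e}
    {n1 : hom n nw} {n2 : hom n ne} {s1 : hom s sw} {s2 : hom s se}
    {w1 : hom w nw} {w2 : hom w sw} {e1 : hom e ne} {e2 : hom e se}
    (pv : pushout zn zs) (ph : pushout zw ze)
    (pn : pushout n1 n2) (ps : pushout s1 s2) (pw : pushout w1 w2) (pe : pushout e1 e2)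
    (a1 : hom (po_ob pv) (po_ob pw)) (a2 : hom (po_ob pv) (po_ob pe))
    (b1 : hom (po_ob ph) (po_ob pn)) (b2 : hom (po_ob ph) (po_ob ps))
    (p : pushout a1 a2) (q : pushout b1 b2) :
  a1 ∘ po_inl pv = po_inl pw ∘ n1 -> a1 ∘ po_inr pv = po_inr pw ∘ s1 ->
  a2 ∘ po_inl pv = po_inl pe ∘ n2 -> a2 ∘ po_inr pv = po_inr pe ∘ s2 ->
  b1 ∘ po_inl ph = po_inl pn ∘ w1 -> b1 ∘ po_inr ph = po_inr pn ∘ e1 ->
  b2 ∘ po_inl ph = po_inl ps ∘ w2 -> b2 ∘ po_inr ph = po_inr ps ∘ e2 ->
  exists (i : hom (po_ob p) (po_ob q)) (j : hom (po_ob q) (po_ob p)),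
    (j ∘ i = idm _ /\ i ∘ j = idm _) /\
    (forall W (k : hom W nw),
       i ∘ (po_inl p ∘ (po_inl pw ∘ k)) = po_inl q ∘ (po_inl pn ∘ k)) /\
    (forall W (k : hom W sw),
       i ∘ (po_inl p ∘ (po_inr pw ∘ k)) = po_inr q ∘ (po_inl ps ∘ k)) /\
    (forall W (k : hom W ne),
       i ∘ (po_inr p ∘ (po_inl pe ∘ k)) = po_inl q ∘ (po_inr pn ∘ k)) /\
    (forall W (k : hom W se),
       i ∘ (po_inr p ∘ (po_inr pe ∘ k)) = po_inr q ∘ (po_inr ps ∘ k)).
Proof.
  intros a1l a1r a2l a2r b1l b1r b2l b2r.
  destruct (pushout_of_pushouts_map p q a1l a1r a2l a2r b1l b1r b2l b2r)
    as (i & (i1 & i2) & i3 & i4).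
  destruct (pushout_of_pushouts_map q p b1l b1r b2l b2r a1l a1r a2l a2r)
    as (j & (j1 & j2) & j3 & j4).
  exists i, j; repeat split.
  1, 2: repeat apply po_ext; rewrite <- !comp_assoc, comp_idl.
  all: rewrite ?i1, ?i2, ?i3, ?i4, ?j1, ?j2, ?j3, ?j4; auto.
  all: intros; rewrite (comp_assoc (po_inl p)) || rewrite (comp_assoc (po_inr p)).
  all: rewrite comp_assoc, ?i1, ?i2, ?i3, ?i4, <- comp_assoc; reflexivity.
Qed.

Lemma diagram_interchange (a b c a' b' c' a'' b'' c'' : C)
    (f : cospan a b) (g : cospan b c) (f' : cospan a' b') (g' : cospan b' c')
    (f'' : cospan a'' b'') (g'' : cospan b'' c'')
    (u : cospan a a') (v : cospan b b') (w : cospan c c')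
    (u' : cospan a' a'') (v' : cospan b' b'') (w' : cospan c' c'')
    (F : diagram f u v f') (F' : diagram f' u' v' f'')
    (G : diagram g v w g') (G' : diagram g' v' w' g'') :
  diagram_iso
    (diagram_hcomp P (diagram_vcomp P F F') (diagram_vcomp P G G'))
    (diagram_vcomp P (diagram_hcomp P F G) (diagram_hcomp P F' G')).
Proof.
  (* The corners are the middle objects of the four squares, the edges are the apexes of the shared
     sides, and the centre is [b']. *)
  destruct (pushout_of_pushouts_iso
      (pv := P (leg2 v) (leg1 v')) (ph := P (leg2 f') (leg1 g'))
      (pn := P (d_right F) (d_left G)) (ps := P (d_right F') (d_left G'))
      (pw := P (d_bot F) (d_top F')) (pe := P (d_bot G) (d_top G'))
      (P (d_right (diagram_vcomp P F F')) (d_left (diagram_vcomp P G G')))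
      (P (d_bot (diagram_hcomp P F G)) (d_top (diagram_hcomp P F' G'))))
    as (i & j & ij & i1 & i2 & i3 & i4); try cat_solve.
  exists i, j; split; [exact ij | repeat split].
  all: simpl in *; repeat apply po_ext; cat_norm; auto.
Qed.

Lemma class_of_surj (T : Type) (R : T -> T -> Prop) (K : classes R) :
  exists t, K = class_of R t.
Proof. destruct K as [K [t ->]]; exists t; reflexivity. Qed.

(** Passing to representatives turns a law between classes into a [diagram_iso]. *)
Ltac to_diagrams :=
  simpl; intros;
  repeat match goal with
  | S : diagram_class _ _ _ _ |- _ => destruct (class_of_surj S) as [? ->]
  end;
  repeat first [rewrite class_map_of | rewrite class_map2_of];
  apply class_of_eq.

Ltac same_middle := exists (idm _), (idm _); repeat split; po_solve.

Lemma two_cosp_is_verity_double_bicategory :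
  is_verity_double_bicategory (two_cosp P).
Proof.
  constructor; [exact (core_is_bicategory _) | exact (core_is_bicategory _) | ..];
    to_diagrams.
  1: apply diagram_interchange.
  all: try solve [same_middle].
  - apply diagram_hassoc.
  - apply diagram_vassoc.
  - apply diagram_hunit_r.
  - apply diagram_hunit_l.
  - apply diagram_vunit_b.
  - apply diagram_vunit_t.
Qed.

End DiagramLaws.

Theorem theorem2 (C : category) (K : finite_colimits C) :
  is_verity_double_bicategory (two_cosp (pushouts_of K)).
Proof. apply two_cosp_is_verity_double_bicategory. Qed.
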